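(* Let $p$ be a prime with $p\equiv 1\pmod 4$, and let $n,k$ be positive integers with $\gcd(n,k)=1$ and $\frac{2n}{\gcd(2n,k)}$ even. Let $F(x)=x^{\frac{p^k+1}{2}}$ over $\mathbb{F}_{p^n}$. The $(-1)$-differential spectrum of $F$ is $$\mathbb S=\left\{{}_{-1}\omega_0=\frac{(p^n+1)(p-1)}{2(p+1)},\ {}_{-1}\omega_1=\frac{p^n-3}{2},\ {}_{-1}\omega_{\frac{p+3}{4}}=2,\ {}_{-1}\omega_{\frac{p+1}{2}}=\frac{p^n-p}{p+1}\right\}$$ when $n$ is odd, and $$\mathbb S=\left\{{}_{-1}\omega_0=\frac{(p^n-1)(p-1)}{2(p+1)},\ {}_{-1}\omega_1=\frac{p^n-1}{2},\ {}_{-1}\omega_{\frac{p+3}{4}}=2,\ {}_{-1}\omega_{\frac{p+1}{2}}=\frac{p^n-p-2}{p+1}\right\}$$ when $n$ is even.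
   Context: For a power function $F(x)=x^d$ over $\mathbb{F}_q$ and $c\in\mathbb{F}_q$, put ${}_c\delta_F(1,b)=\#\{x\in\mathbb{F}_q : F(x+1)-cF(x)=b\}$ and ${}_c\omega_i=\#\{b\in\mathbb{F}_q : {}_c\delta_F(1,b)=i\}$. Saying that the $c$-differential spectrum is $\mathbb S=\{{}_c\omega_{i}=v_{i},\dots\}$ means that the listed ${}_c\omega_i$ have the listed values (possibly $0$ for small parameters) and ${}_c\omega_j=0$ for every $j$ not listed. Here $c=-1$. *)

(* Defs.v *)
From mathcomp Require Import all_boot all_order all_algebra.

Set Implicit Arguments.
Unset Strict Implicit.
Unset Printing Implicit Defensive.

Import GRing.Theory.
Local Open Scope ring_scope.

Definition cdelta (K : finFieldType) (c : K) (f : K -> K) (a b : K) : nat :=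
  #|[set x : K | f (x + a) - c * f x == b]|.

(* Only a = 1 is used: for a power function the other nonzero a give the same
   multiset of values. *)
Definition comega (K : finFieldType) (c : K) (f : K -> K) (i : nat) : nat :=
  #|[set b : K | cdelta c f 1 b == i]|.

(* S lists pairs (i, v), read as "omega_i = v"; omega vanishes at every index
   that is not listed. The values v are rationals so that quotients in them are
   exact; v = 0 is allowed. *)
Definition has_cdiff_spectrum (K : finFieldType) (c : K) (f : K -> K)
    (S : seq (nat * rat)) : Prop :=
  (forall i v, (i, v) \in S -> (comega c f i)%:R = v) /\
  (forall j, j \notin unzip1 S -> comega c f j = 0%N).

(* Main.v *)
(* Write q = p^n and d = (p^k + 1)/2; the hypotheses force k to be odd. The
   substitution 4x + 2 = t + 1/t turns (x+1)^d + x^d into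
   (2/4^d) (t^d + t^-d), that is, into a Dickson polynomial. The parameter t
   ranges over the union of the groups of (q-1)-th and (q+1)-th roots of unity
   in an extension of F_q, modulo t <-> 1/t. On one of these two cyclic groups
   t |-> t^d is a bijection, on the other one it is e-to-one with
   e = (p + 1)/2, the parity of n deciding which is which. The two groups meet
   in {1, -1}, whose fibres have (e + 1)/2 elements modulo inversion. *)

Require Import Defs.
From mathcomp Require Import all_boot all_order all_algebra all_solvable.
From mathcomp Require Import all_field.
From mathcomp Require Import ring zify.

Set Implicit Arguments.
Unset Strict Implicit.
Unset Printing Implicit Defensive.

(** * Powers of an integer modulo [m] *)

Lemma expn_odd_mod a m i : odd i -> a * a = 1 %[mod m] -> a ^ i = a %[mod m].
Proof.
move=> odd_i sq; rewrite -(odd_double_half i) odd_i add1n expnS -muln2 mulnC.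
by rewrite (mulnC _ 2) expnM -mulnn -modnMml -modnXm sq modnXm exp1n modnMml mul1n.
Qed.

Lemma expn_even_mod a m i : ~~ odd i -> a * a = 1 %[mod m] ->
  a ^ i = 1 %[mod m].
Proof.
move=> even_i sq; rewrite -(odd_double_half i) (negbTE even_i) -muln2.
by rewrite mulnC expnM -mulnn -modnXm sq modnXm exp1n.
Qed.

(** Bezout in the form [u * i = w * j + 1], with natural coefficients, so that no inverse of [a]
    modulo [m] is needed. *)
Lemma expn_coprime_eq1 a m i j : 0 < i -> coprime i j ->
  a ^ i = 1 %[mod m] -> a ^ j = 1 %[mod m] -> a = 1 %[mod m].
Proof.
move=> i_gt0 /eqP co ai aj; case: (egcdnP j i_gt0) => u w.
rewrite co => E _.
have : a ^ (u * i) = a ^ (w * j + 1) %[mod m] by rewrite E.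
rewrite expnD expn1 (mulnC u) (mulnC w) !expnM -modnXm ai modnXm exp1n.
by rewrite -modnMml -[(a ^ j) ^ w %% m]modnXm aj modnXm exp1n modnMml mul1n.
Qed.


(** * The gcds of [d] with [p ^ n - 1] and [p ^ n + 1] *)

Section Gcd.

Variables p n k : nat.
Hypothesis p_mod4 : p = 1 %[mod 4].

Let d := (p ^ k + 1) %/ 2.
Let e := (p + 1) %/ 2.

Lemma expn_mod4 j : p ^ j = 1 %[mod 4].
Proof. by rewrite -modnXm p_mod4 modnXm exp1n. Qed.

Lemma double_half_pow : d * 2 = p ^ k + 1.
Proof. have := expn_mod4 k; rewrite /d; lia. Qed.

Lemma odd_half_pow : odd d.
Proof. have := expn_mod4 k; rewrite /d; lia. Qed.

Lemma double_half_succ : e * 2 = p + 1.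
Proof. move: p_mod4; rewrite /e; lia. Qed.

Lemma odd_half_succ : odd e.
Proof. move: p_mod4; rewrite /e; lia. Qed.

Lemma sqr_mod_succ : p * p = 1 %[mod p + 1].
Proof.
have -> : p * p = (p - 1) * (p + 1) + 1 by move: p_mod4; nia.
by rewrite modnMDl.
Qed.

Hypotheses (n_gt0 : 0 < n) (k_odd : odd k) (co_nk : coprime n k).

Lemma dvdn_half m : p + 1 %| 2 * m -> e %| m.
Proof. by rewrite -double_half_succ mulnC dvdn_pmul2l. Qed.

(** Modulo [p + 1] the square of [p] is 1 and [k] is odd, so [p ^ k + 1], which is [2 * d], reduces
    to [p + 1], that is, to 0; then halve. *)
Lemma half_succ_dvd_half_pow : e %| d.
Proof.
apply: dvdn_half; rewrite mulnC double_half_pow /dvdn -modnDml.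
by rewrite (expn_odd_mod k_odd sqr_mod_succ) modnDml modnn.
Qed.

(* A common divisor g of d and q^2 - 1 divides p^(2k) - 1 and p^(2n) - 1, hence
   p^2 - 1; modulo g the powers of p are then 1 or p by parity. *)
Lemma sqr_mod_gcd m : m %| p ^ n * p ^ n - 1 -> p * p = 1 %[mod gcdn d m].
Proof.
set g := gcdn d m => dm.
have p_gt0 : 0 < p by move: p_mod4; case: (p).
have sqE i : (p * p) ^ i = p ^ i * p ^ i by rewrite expnMn.
apply: (expn_coprime_eq1 n_gt0 co_nk); rewrite sqE; apply/eqP.
  rewrite eqn_mod_dvd ?muln_gt0 ?expn_gt0 ?p_gt0 //.
  exact: dvdn_trans (dvdn_gcdr _ _) dm.
rewrite eqn_mod_dvd ?muln_gt0 ?expn_gt0 ?p_gt0 //.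
apply: (dvdn_trans (dvdn_gcdl _ _)).
have -> : p ^ k * p ^ k - 1 = d * (2 * (p ^ k - 1)).
  rewrite mulnA double_half_pow; have : 0 < p ^ k by rewrite expn_gt0 p_gt0.
  nia.
exact: dvdn_mulr.
Qed.

Lemma gcd_dvd_succ m : m %| p ^ n * p ^ n - 1 -> gcdn d m %| p + 1.
Proof.
move=> /sqr_mod_gcd sq.
have : gcdn d m %| p ^ k + 1.
  by rewrite -double_half_pow (dvdn_trans (dvdn_gcdl _ _)) ?dvdn_mulr.
by rewrite /dvdn -modnDml (expn_odd_mod k_odd sq) modnDml.
Qed.

Lemma odd_gcd m : odd (gcdn d m).
Proof. exact: dvdn_odd (dvdn_gcdl _ _) odd_half_pow. Qed.

(** The gcd divides [p + 1 = 2 * e] and is odd, since [p] being 1 modulo 4 makes [d] odd; hence it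
    divides [e]. Conversely [e] divides both [d] and [m]. *)
Lemma gcd_eq_half m : m %| p ^ n * p ^ n - 1 -> e %| m -> gcdn d m = e.
Proof.
move=> dm em; apply/eqP; rewrite eqn_dvd dvdn_gcd half_succ_dvd_half_pow em.
have := gcd_dvd_succ dm; rewrite -double_half_succ Gauss_dvdl.
  by move=> ->.
by rewrite coprimen2 odd_gcd.
Qed.

Lemma gcd_eq1 m : gcdn d m %| 2 -> gcdn d m = 1.
Proof.
have := odd_gcd m; move: (gcdn d m) => g og /dvdn_leq-/(_ isT).
by case: g og => [|[|[|]]].
Qed.

Lemma pred_dvd : p ^ n - 1 %| p ^ n * p ^ n - 1.
Proof.
have -> : p ^ n * p ^ n - 1 = (p ^ n - 1) * (p ^ n + 1) by nia.
exact: dvdn_mulr.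
Qed.

Lemma succ_dvd : p ^ n + 1 %| p ^ n * p ^ n - 1.
Proof.
have -> : p ^ n * p ^ n - 1 = (p ^ n - 1) * (p ^ n + 1) by nia.
exact: dvdn_mull.
Qed.

Lemma gcds_odd : odd n ->
  gcdn d (p ^ n - 1) = 1 /\ gcdn d (p ^ n + 1) = e.
Proof.
move=> odd_n; split.
  apply: gcd_eq1.
  have p_gt0 : 0 < p by move: p_mod4; case: (p).
  have h1 := gcd_dvd_succ pred_dvd.
  (* For odd [n], [p ^ n] is [p] modulo the gcd. The gcd thus divides both [p + 1] and [p - 1],
     hence 2. *)
  have : gcdn d (p ^ n - 1) %| p - 1.
    rewrite -eqn_mod_dvd //.
    rewrite -(expn_odd_mod odd_n (sqr_mod_gcd pred_dvd)).
    by rewrite eqn_mod_dvd ?dvdn_gcdr // expn_gt0 p_gt0.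
  move=> h2; have := dvdn_sub h1 h2; congr (_ %| _); lia.
apply: gcd_eq_half succ_dvd _; apply: dvdn_half; apply: dvdn_mull.
by rewrite /dvdn -modnDml (expn_odd_mod odd_n sqr_mod_succ) modnDml modnn.
Qed.

Lemma gcds_even : ~~ odd n ->
  gcdn d (p ^ n + 1) = 1 /\ gcdn d (p ^ n - 1) = e.
Proof.
move=> even_n; split.
  apply: gcd_eq1.
  (* For even [n], [p ^ n] is 1 modulo the gcd, so [p ^ n + 1] reduces to 2. *)
  have : gcdn d (p ^ n + 1) %| p ^ n + 1 by apply: dvdn_gcdr.
  by rewrite /dvdn -modnDml (expn_even_mod even_n (sqr_mod_gcd succ_dvd)) modnDml.
apply: gcd_eq_half pred_dvd _; apply: dvdn_half; apply: dvdn_mull.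
rewrite -eqn_mod_dvd ?(expn_even_mod even_n sqr_mod_succ) //.
by rewrite expn_gt0; move: p_mod4; case: (p).
Qed.

End Gcd.

(** If [k] were even, [n] would be odd by coprimality and [gcdn (2 * n) k] would be 2, leaving the
    odd quotient [n]. *)
Lemma odd_of_even_quo n k : 0 < n -> coprime n k ->
  ~~ odd ((2 * n) %/ gcdn (2 * n) k) -> odd k.
Proof.
move=> n_gt0 co; apply: contraNT => k_even.
have n_odd : odd n.
  apply: contraTT co => n_even; rewrite /coprime gtn_eqF //.
  by apply: (@dvdn_leq 2); rewrite ?gcdn_gt0 ?n_gt0 // dvdn_gcd !dvdn2 n_even.
by rewrite gcdnC Gauss_gcdl 1?coprime_sym // (gcdn_idPr _) ?dvdn2 // mulKn.
Qed.

Import GRing.Theory.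
Local Open Scope ring_scope.

(** * A finite extension containing the required roots *)

Lemma finField_split (K : finFieldType) (P : {poly K}) : P != 0 ->
  exists (L : finFieldType) (iota : {rmorphism K -> L}) (rs : seq L),
    map_poly iota P %= \prod_(r <- rs) ('X - r%:P).
Proof.
move=> /FinSplittingFieldFor [L [rs Drs _]].
by exists (FinFieldExtType L), (in_alg L), rs.
Qed.

(** As [m] is nonzero in [L], ['X^m - 1] is separable and has [m] distinct roots; that many roots of
    unity force a primitive one. *)
Lemma split_prim_root (L : fieldType) (Q : {poly L}) (rs : seq L) (m : nat) :
  Q %= \prod_(r <- rs) ('X - r%:P) -> 'X^m - 1 %| Q -> (m%:R : L) != 0 ->
  exists z : L, m.-primitive_root z.
Proof.
move=> DQ; rewrite (eqp_dvdr _ DQ) => dvd nz.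
have m_gt0 : (0 < m)%N by case: m nz {dvd}; rewrite ?eqxx.
have [msk] := dvdp_prod_XsubC dvd; set ts := mask _ _ => eq_ts.
have mon : 'X^m - 1 = \prod_(r <- ts) ('X - r%:P) :> {poly L}.
  apply/eqP; rewrite -eqp_monic ?monic_prod_XsubC //.
  by rewrite monicXnsubC.
have uts : uniq ts.
  rewrite -separable_prod_XsubC -mon.
  by rewrite cyclotomic.separable_Xn_sub_1.
have sz : size ts = m.
  by apply/eq_add_S; rewrite -(size_prod_XsubC ts id) -mon size_XnsubC.
have := @cyclic.has_prim_root _ m ts m_gt0 _ uts.
rewrite sz leqnn => /(_ _ isT) H.
have /hasP[z _ ?] : has m.-primitive_root ts.
  apply: H; apply/allP => x xts.
  by move: xts; rewrite -root_prod_XsubC -mon.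
by exists z.
Qed.

(** A single polynomial is split: the product of ['X^m0 - 1], ['X^m1 - 1] and all ['X^2 - v 'X + 1].
    A root [t] of the last factor is nonzero and satisfies [v = t + t^-1]. *)
Lemma exists_dickson_extension (K : finFieldType) (m0 m1 : nat) :
  (m0%:R : K) != 0 -> (m1%:R : K) != 0 ->
  exists (L : finFieldType) (iota : {rmorphism K -> L}),
    [/\ exists z : L, m0.-primitive_root z,
        exists z : L, m1.-primitive_root z &
        forall v, exists2 t, t != 0 & iota v = t + t^-1].
Proof.
move=> m0_nz m1_nz.
have nz m : (m%:R : K) != 0 -> 'X^m - 1 != 0 :> {poly K}.
  case: m => [|m _]; first by rewrite eqxx.
  by rewrite monic_neq0 ?monicXnsubC.
pose S v : {poly K} := 'X^2 - v%:P * 'X + 1.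
have hS (R : comNzRingType) (f : {rmorphism K -> R}) v x :
    (map_poly f (S v)).[x] = x ^+ 2 - f v * x + 1.
  rewrite rmorphD rmorphB !rmorphM rmorph1 /= map_polyX map_polyC.
  by rewrite !hornerE.
have Snz v : S v != 0.
  apply: contra_eq_neq (hS _ idfun v 0) => /= ->.
  by rewrite map_poly0 horner0 expr0n mulr0 subr0 add0r eq_sym oner_neq0.
have [|L [iota [rs Dr]]] := @finField_split K
    (('X^m0 - 1) * ('X^m1 - 1) * \prod_v S v).
  by rewrite !mulf_neq0 ?nz //; apply/prodf_neq0.
exists L, iota.
have nzL m : (m%:R : K) != 0 -> (m%:R : L) != 0.
  by rewrite -(rmorph_nat iota) fmorph_eq0.
have eX m : map_poly iota ('X^m - 1) = 'X^m - 1.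
  by rewrite rmorphB rmorph1 /= map_polyXn.
rewrite !rmorphM /= !eX rmorph_prod /= in Dr.
split.
- apply: split_prim_root Dr _ (nzL _ m0_nz).
  by rewrite -mulrA dvdp_mulr.
- apply: split_prim_root Dr _ (nzL _ m1_nz).
  by rewrite mulrAC dvdp_mull.
move=> v; have dv : map_poly iota (S v) %| \prod_(r <- rs) ('X - r%:P).
  rewrite -(eqp_dvdr _ Dr); apply: dvdp_mull.
  by rewrite (bigD1 v) //= dvdp_mulr.
(* The list of roots is nonempty because [S v] has degree 2; its head is the desired [t]. *)
have [msk] := dvdp_prod_XsubC dv; case: (mask msk rs) => [|t ts] eqt.
  have := eqp_size eqt; rewrite size_prod_XsubC size_map_poly.
  rewrite /S -addrA size_polyDl ?size_polyXn // (leq_ltn_trans (size_polyD _ _)) //.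
  rewrite gtn_max size_polyN size_poly1 andbT.
  rewrite (leq_ltn_trans (size_polyMleq _ _)) // size_polyX.
  by rewrite size_polyC; case: (v != 0).
have := eqp_root eqt t; rewrite big_cons rootM root_XsubC eqxx rootE hS => /eqP Et.
have tnz : t != 0.
  apply/eqP => t0; move: Et; rewrite t0 expr0n mulr0 subr0 add0r => /eqP.
  by rewrite oner_eq0.
exists t => //.
have E : iota v * t = t ^+ 2 + 1.
  by rewrite -[RHS]subr0 -Et; ring.
by apply: (mulIf tnz); rewrite E; field.
Qed.

(** * The Joukowsky map and power maps on roots of unity *)

Section Joukowsky.

Variable L : finFieldType.
Implicit Types (s t z : L) (A : {set L}).

Definition J t := t + t^-1.

Lemma JV t : J t^-1 = J t.
Proof. by rewrite /J invrK addrC. Qed.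

Lemma eq_J s t : s != 0 -> t != 0 -> (J s == J t) = (s == t) || (s == t^-1).
Proof.
move=> s0 t0; have E : J s - J t = (s - t) * (s - t^-1) / s.
  by rewrite /J; field; rewrite s0 t0.
by rewrite -subr_eq0 E !mulf_eq0 invr_eq0 (negbTE s0) orbF !subr_eq0.
Qed.

(* The fibre of J through t is {t, 1/t}, with two elements unless t^2 = 1. *)
Lemma card_J_imset A : 0 \notin A -> (forall t, t \in A -> t^-1 \in A) ->
  (2 * #|J @: A| = #|A| + #|[set t in A | (t ^+ 2 == 1)%R]|)%N.
Proof.
move=> A0 AV; have nz t : t \in A -> t != 0 by apply: contraTneq => ->.
rewrite -!sum1_card big_distrr /= [X in (X + _)%N](partition_big_imset J) /=.
rewrite [X in (_ + X)%N](partition_big J (fun y => y \in J @: A)) /=; last first.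
  by move=> t; rewrite inE => /andP[tA _]; apply: imset_f.
rewrite -big_split /=; apply: eq_bigr => _ /imsetP[t tA ->].
have fib x : (x \in A) && (J x == J t) = (x \in [set t; t^-1]).
  rewrite !inE; apply/andP/orP => [[xA]|].
    by rewrite eq_J ?nz // => /orP.
  by case=> /eqP ->; rewrite ?JV ?AV.
rewrite (eq_bigl _ _ fib).
have fib2 x : (x \in [set t in A | t ^+ 2 == 1]) && (J x == J t) =
    (x \in [set x in [set t; t^-1] | x ^+ 2 == 1]).
  by rewrite inE andbAC fib inE.
rewrite (eq_bigl _ _ fib2) !sum1_card cards2.
have t0 := nz _ tA.
have -> : (t == t^-1) = (t ^+ 2 == 1).
  by rewrite -(inj_eq (mulIf t0)) mulVf // expr2.
have [t2|t2] := boolP (t ^+ 2 == 1).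
  have tV : t^-1 = t by apply: (mulfI t0); rewrite -expr2 (eqP t2) mulfV.
  suff -> : [set x in [set t; t^-1] | x ^+ 2 == 1] = [set t] by rewrite cards1.
  apply/setP => x; rewrite !inE tV orbb; have [->|//] := eqVneq x t.
  by rewrite t2.
suff -> : [set x in [set t; t^-1] | x ^+ 2 == 1] = set0 by rewrite cards0.
apply/setP => x; rewrite !inE; apply/andP => -[/orP[]/eqP->].
  exact/negP.
by rewrite exprVn invr_eq1; apply/negP.
Qed.

Lemma unity_neq0 m t : (0 < m)%N -> t ^+ m = 1 -> t != 0.
Proof.
move=> m_gt0; apply: contra_eq_neq => ->.
by rewrite expr0n gtn_eqF // eq_sym oner_neq0.
Qed.

Lemma card_unity m z : m.-primitive_root z -> #|[set t : L | t ^+ m == 1]| = m.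
Proof.
move=> zP; rewrite -[RHS]card_ord.
rewrite -(card_imset _ (_ : injective (fun i : 'I_m => z ^+ i))).
  apply: eq_card => t; rewrite inE; apply/eqP/imsetP.
    move=> /(prim_rootP zP)[i ->].
    by exists i.
  by case=> i _ ->; rewrite exprAC (prim_expr_order zP) expr1n.
move=> i j /eqP; rewrite (eq_prim_root_expr zP) !modn_small // => /eqP.
exact: val_inj.
Qed.

Lemma prim_root_dvd m z e : m.-primitive_root z -> (e %| m)%N ->
  e.-primitive_root (z ^+ (m %/ e)%N).
Proof.
move=> zP em; have m_gt0 := prim_order_gt0 zP.
have := exp_prim_root zP (m %/ e)%N.
by rewrite (gcdn_idPl _) ?dvdn_div // divnA // mulKn.
Qed.

Lemma card_unity_dvd m z e : m.-primitive_root z -> (e %| m)%N ->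
  #|[set t : L | t ^+ e == 1]| = e.
Proof. by move=> zP em; apply: card_unity (prim_root_dvd zP em). Qed.

(** On the cyclic group of order [m], the map [t |-> t ^+ d] has the [g]-th roots of unity as kernel
    and the [(m / g)]-th ones as image, where [g = gcdn d m]. A fibre is thus empty or a coset of
    the kernel. *)
Lemma card_unity_pow m z d s : m.-primitive_root z -> (0 < d)%N ->
  #|[set t : L | (t ^+ m == 1) && (t ^+ d == s)]| =
  if s ^+ (m %/ gcdn d m)%N == 1 then gcdn d m else 0%N.
Proof.
move=> zP d_gt0; have m_gt0 := prim_order_gt0 zP.
set g := gcdn d m; have g_gt0 : (0 < g)%N by rewrite gcdn_gt0 d_gt0.
have [gd gm] : (g %| d)%N /\ (g %| m)%N by rewrite dvdn_gcdl dvdn_gcdr.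
have [sP|sP] := ifPn; last first.
  apply/eqP; rewrite cards_eq0 -subset0; apply/subsetP => t; rewrite !inE.
  case/andP => /eqP tm /eqP ts; move: sP; rewrite -ts -exprM.
  by rewrite -(divnK gd) -mulnA [(g * _)%N]mulnC divnK // mulnC exprM tm expr1n eqxx.
have sm : s ^+ m = 1 by rewrite -(divnK gm) exprM (eqP sP) expr1n.
have [i Ds] := prim_rootP zP sm.
have gi : (g %| i)%N.
  move: sP; rewrite Ds -exprM -(prim_order_dvd zP) -{1}(divnK gm) mulnC.
  by rewrite dvdn_pmul2r // divn_gt0 // dvdn_leq.
have [u w Eg _] := egcdnP m d_gt0.
(* With [s = z ^+ i], [g] dividing [i] and [u * d = w * m + g], raising [t0] to the power [d] gives
   [z ^+ i]. *)
pose t0 := z ^+ (i %/ g * u)%N.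
have t0m : t0 ^+ m = 1 by rewrite exprAC (prim_expr_order zP) expr1n.
have t0d : t0 ^+ d = s.
  rewrite -exprM -mulnA Eg mulnDr divnK // exprD Ds mulnA mulnC exprM.
  by rewrite (prim_expr_order zP) expr1n mul1r.
have t0_nz := unity_neq0 m_gt0 t0m.
rewrite -[RHS](card_unity_dvd zP gm) -[RHS](card_imset _ (mulfI t0_nz)).
apply: eq_card => t; rewrite inE; apply/andP/imsetP.
  (* The quotient of two solutions is killed by both [d] and [m], hence by their gcd. *)
  case=> /eqP tm /eqP td; exists (t0^-1 * t); last by rewrite mulVKf.
  have ym : (t0^-1 * t) ^+ m = 1 by rewrite exprMn exprVn t0m tm invr1 mulr1.
  rewrite inE; have [j Dt] := prim_rootP zP ym.
  have -> : (t0^-1 * t) ^+ g == 1 = (m %| j * g)%N.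
    by rewrite Dt -exprM (prim_order_dvd zP).
  rewrite muln_gcdr dvdn_gcd (dvdn_mull j (dvdnn m)) andbT (prim_order_dvd zP) exprM -Dt.
  by rewrite exprMn exprVn t0d td mulVf // -t0d expf_neq0.
case=> x; rewrite inE => /eqP xg ->; rewrite !exprMn t0m t0d.
rewrite -(divnK gm) -[in x ^+ d](divnK gd).
by rewrite ![(_ * g)%N]mulnC !exprM xg !expr1n !mulr1 !eqxx.
Qed.


(** * Fibres of the power map, with [m0] and [m1] standing for q - 1 and q + 1 in either order *)

Section Fibres.

Variables (m0 m1 d : nat) (z0 z1 : L).
Hypotheses (z0P : m0.-primitive_root z0) (z1P : m1.-primitive_root z1).
Hypothesis unity_meet : forall t, t ^+ m0 = 1 -> t ^+ m1 = 1 -> t ^+ 2 = 1.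
Hypotheses (m0_even : ~~ odd m0) (m1_even : ~~ odd m1) (d_odd : odd d).
Hypotheses (two_nz : 2%:R != 0 :> L) (co_d_m0 : gcdn d m0 = 1%N).
Hypothesis e_gt1 : (1 < gcdn d m1)%N.

Let e := gcdn d m1.
(* In the application J maps V onto the copy of F_q in L. *)
Let V := [set t : L | (t ^+ m0 == 1) || (t ^+ m1 == 1)].
Let T s := [set t in V | t ^+ d == s].
(** When [J s] is the image of some [b] in F_q, this turns out to be the differential count at a
    fixed multiple of [b]. *)
Let N s := #|J @: T s|.

Let d_gt0 : (0 < d)%N. Proof. exact: odd_gt0. Qed.
Let m0_gt0 := prim_order_gt0 z0P.
Let m1_gt0 := prim_order_gt0 z1P.
Let e_odd : odd e. Proof. exact: dvdn_odd (dvdn_gcdl _ _) d_odd. Qed.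
Let e_dvd : (e %| m1)%N. Proof. exact: dvdn_gcdr. Qed.
Let quo_even : ~~ odd (m1 %/ e)%N.
Proof. by apply: contra m1_even => oq; rewrite -(divnK e_dvd) oddM oq e_odd. Qed.

Lemma expr_even_sqr1 s j : s ^+ 2 = 1 -> ~~ odd j -> s ^+ j = 1.
Proof.
move=> s2 ej; rewrite -(odd_double_half j) (negbTE ej) -muln2 mulnC exprM s2.
by rewrite expr1n.
Qed.

Lemma expr_odd_sqr1 s j : s ^+ 2 = 1 -> odd j -> s ^+ j = s.
Proof. by case: j => // j s2 oj; rewrite exprS expr_even_sqr1 ?mulr1. Qed.

Lemma V_neq0 t : t \in V -> t != 0.
Proof. by rewrite inE => /orP[] /eqP; apply: unity_neq0. Qed.

Lemma V_inv t : t \in V -> t^-1 \in V.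
Proof. by rewrite !inE !exprVn !invr_eq1. Qed.

(** [J] is injective on [T s]: if [x] and [x^-1] both had [d]-th power [s], then [s] would equal its
    inverse. *)
Lemma card_J_T s : s ^+ 2 != 1 -> s \in V -> N s = #|T s|.
Proof.
move=> s2 sV; apply: card_in_imset => x y; rewrite !inE.
case/andP=> xV /eqP xs /andP[yV /eqP ys] /eqP.
have [x0 y0] : x != 0 /\ y != 0 by split; apply: V_neq0; rewrite inE.
rewrite eq_J // => /orP[/eqP //|/eqP Dx].
have Ds : s = s^-1 by rewrite -{1}xs Dx exprVn ys.
by move: s2; rewrite expr2 {2}Ds mulfV ?eqxx // V_neq0.
Qed.

(** The power map is bijective on the [m0]-th roots of unity. A preimage among the [m1]-th roots
    would put [s] in both groups, forcing [s ^+ 2 = 1]. *)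
Lemma N_unity0 s : s ^+ m0 = 1 -> s ^+ 2 != 1 -> N s = 1%N.
Proof.
move=> sm s2; have sV : s \in V by rewrite inE sm eqxx.
rewrite card_J_T //; have := card_unity_pow s z0P d_gt0.
rewrite co_d_m0 divn1 sm eqxx => <-; apply: eq_card => t; rewrite !inE.
apply: andb_id2r => /eqP td; have [//|tm0] := eqVneq (t ^+ m0) 1.
apply/negbTE; apply: contra s2 => /eqP tm1.
by rewrite (unity_meet sm) // -td exprAC tm1 expr1n.
Qed.

Lemma N_unity1 s : s ^+ m1 = 1 -> s ^+ 2 != 1 ->
  N s = if s ^+ (m1 %/ e)%N == 1 then e else 0%N.
Proof.
move=> sm s2; have sV : s \in V by rewrite inE sm eqxx orbT.
rewrite card_J_T // -(card_unity_pow s z1P d_gt0).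
apply: eq_card => t; rewrite !inE; apply: andb_id2r => /eqP td.
have [tm0|//] := eqVneq (t ^+ m0) 1.
case/eqP: s2; apply: unity_meet => //.
by rewrite -td exprAC tm0 expr1n.
Qed.

(** The fibre over [s] lies in the group of order [m1], has [e] elements and is stable under
    inversion; its only self-inverse element is [s]. *)
Lemma N_sqr1 s : s ^+ 2 = 1 -> (2 * N s = e.+1)%N.
Proof.
move=> s2; have s0 : s != 0 by apply: (unity_neq0 _ s2).
have DT : T s = [set t | (t ^+ m1 == 1) && (t ^+ d == s)].
  apply/setP => t; rewrite !inE; apply: andb_id2r => /eqP td.
  have [tm0|//] := eqVneq (t ^+ m0) 1; apply/esym/eqP.
  (* By parity [s] is itself an [m0]-th root of unity with [d]-th power [s]. Uniqueness gives
     [t = s], which is also an [m1]-th root of unity. *)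
  have : #|[set t | (t ^+ m0 == 1) && (t ^+ d == s)]| = 1%N.
    by rewrite (card_unity_pow s z0P d_gt0) co_d_m0 divn1 expr_even_sqr1 ?eqxx.
  move/eqP/cards1P => [x /setP Dx].
  have := Dx t; have := Dx s; rewrite !inE td tm0 !eqxx.
  rewrite (expr_even_sqr1 s2 m0_even) (expr_odd_sqr1 s2 d_odd) !eqxx /=.
  by move=> /esym/eqP Ds /esym/eqP ->; rewrite -Ds expr_even_sqr1.
rewrite card_J_imset.
- rewrite DT (card_unity_pow s z1P d_gt0) expr_even_sqr1 // eqxx -[RHS]addn1.
  congr (_ + _)%N; rewrite -[RHS](cards1 s); apply: eq_card => t; rewrite !inE.
  apply/andP/eqP => [[/andP[_ /eqP <-]]|->].
    by move=> /eqP t2; rewrite (expr_odd_sqr1 t2 d_odd).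
  by rewrite (expr_even_sqr1 s2 m1_even) (expr_odd_sqr1 s2 d_odd) s2 !eqxx.
- by apply/negP => /setIdP[/V_neq0]; rewrite eqxx.
move=> t /setIdP[tV /eqP td]; apply/setIdP; split; first exact: V_inv.
rewrite exprVn td.
by rewrite -(inj_eq (mulfI s0)) mulfV // -expr2 s2.
Qed.

(** * Sizes of the level sets of [N] modulo inversion *)

Let W j := [set s in V | N s == j].

Let two_unity : #|[set s : L | s ^+ 2 == 1]| = 2.
Proof.
have D : [set s : L | s ^+ 2 == 1] = [set 1; -1].
  by apply/setP => s; rewrite !inE sqrf_eq1.
by rewrite D cards2 -addr_eq0 two_nz.
Qed.

Lemma N_class s : s \in V -> N s =
  if s ^+ 2 == 1 then (e.+1)./2 else
  if s ^+ m0 == 1 then 1%N else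
  if s ^+ (m1 %/ e)%N == 1 then e else 0%N.
Proof.
rewrite inE => sV; have [s2|s2] := ifPn.
  by rewrite -(N_sqr1 (eqP s2)) mul2n doubleK.
have [/eqP sm|sm] := ifPn; first exact: N_unity0.
by apply: N_unity1 => //; apply/eqP; rewrite (negbTE sm) in sV.
Qed.

(** This makes the four indices 0, 1, [(e.+1)./2] and [e] pairwise distinct. *)
Let e_gt2 : (2 < e)%N. Proof. by move: e_gt1 e_odd; rewrite -/e; case: e => [|[|[|]]]. Qed.
Let half_gt1 : (1 < (e.+1)./2)%N. Proof. lia. Qed.
Let half_lt : ((e.+1)./2 < e)%N. Proof. lia. Qed.

Lemma W_inv j t : t \in W j -> t^-1 \in W j.
Proof.
move=> /setIdP[tV Nt]; apply/setIdP; split; first exact: V_inv.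
move: Nt; by rewrite !N_class ?V_inv // !exprVn !invr_eq1.
Qed.

Lemma card_J_Wj j : (2 * #|J @: W j| = #|W j| + #|[set t in W j | (t ^+ 2 == 1)%R]|)%N.
Proof.
apply: card_J_imset; last exact: W_inv.
by apply/negP => /setIdP[/V_neq0]; rewrite eqxx.
Qed.

Lemma in_W j s : (s \in W j) = (s \in V) &&
  (j == if s ^+ 2 == 1 then (e.+1)./2 else
  if s ^+ m0 == 1 then 1%N else
  if s ^+ (m1 %/ e)%N == 1 then e else 0%N).
Proof. by rewrite [LHS]inE; apply: andb_id2l => /N_class ->; rewrite eq_sym. Qed.

Lemma quo_unity s : s ^+ (m1 %/ e)%N = 1 -> s ^+ m1 = 1.
Proof. by move=> sq; rewrite -(divnK e_dvd) exprM sq expr1n. Qed.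

(** The self-inverse elements all have [N s = (e.+1)./2], so [J] exactly halves every other level
    set. *)
Lemma sqr1_notin j : j != (e.+1)./2 -> #|[set t in W j | (t ^+ 2 == 1)%R]| = 0%N.
Proof.
move=> nj; apply/eqP; rewrite cards_eq0 -subset0; apply/subsetP => t.
by rewrite inE in_W => /andP[/andP[_ +] t2]; rewrite t2 (negbTE nj).
Qed.

Lemma card_diff_sqr1 m z : m.-primitive_root z -> ~~ odd m ->
  #|[set s : L | (s ^+ m == 1) && (s ^+ 2 != 1)]| = (m - 2)%N.
Proof.
move=> zP m_even; rewrite -{2}(card_unity zP) -[X in (_ - X)%N]two_unity -cardsDS.
  by apply: eq_card => s; rewrite !inE andbC.
by apply/subsetP => s; rewrite !inE => /eqP s2; rewrite expr_even_sqr1.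
Qed.

Lemma double_card_JW1 : (2 * #|J @: W 1| = m0 - 2)%N.
Proof.
rewrite card_J_Wj sqr1_notin ?ltn_eqF // addn0 -(card_diff_sqr1 z0P) //.
apply: eq_card => s; rewrite in_W !inE.
have [s2|s2] := ifPn; first by rewrite ltn_eqF // !andbF.
have [s0|s0] := ifPn; first by [].
by case: ifP => _; rewrite ?(ltn_eqF e_gt1) ?andbF.
Qed.

(** This level set consists of the [d]-th powers in the group of order [m1], a subgroup of even
    order [m1 %/ e], without 1 and -1. *)
Lemma double_card_JWe : (2 * #|J @: W e| = m1 %/ e - 2)%N.
Proof.
rewrite card_J_Wj sqr1_notin ?gtn_eqF // addn0.
have q_dvd : (m1 %/ e %| m1)%N by rewrite dvdn_div.
rewrite -(card_diff_sqr1 (prim_root_dvd z1P q_dvd)) //.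
apply: eq_card => s; rewrite in_W !inE.
have [s2|s2] := ifPn; first by rewrite gtn_eqF // !andbF.
have [s0|s0] := ifPn.
  rewrite gtn_eqF // andbF; apply/esym; apply: contraNF s2.
  by rewrite andbT => /eqP/quo_unity sm; rewrite unity_meet // (eqP s0).
case: ifP => [/eqP/quo_unity ->|_]; first by rewrite !eqxx orbT.
by rewrite gtn_eqF ?andbF // ltnW // ltnW.
Qed.

(** Here the level set is the group of order [m1] without its [d]-th powers; 1 and -1 are among the
    latter because [m1 %/ e] is even. *)
Lemma double_card_JW0 : (2 * #|J @: W 0| = m1 - m1 %/ e)%N.
Proof.
rewrite card_J_Wj sqr1_notin ?ltn_eqF // ?addn0; last by rewrite ltnW.
have q_dvd : (m1 %/ e %| m1)%N by rewrite dvdn_div.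
rewrite -[X in (X - _)%N](card_unity z1P) -(card_unity_dvd z1P q_dvd) -cardsDS; last first.
  by apply/subsetP => s; rewrite !inE => /eqP/quo_unity ->.
apply: eq_card => s; rewrite in_W !inE.
have [s2|s2] := ifPn.
  rewrite ltn_eqF 1?ltnW // andbF; apply/esym/negbTE.
  by rewrite expr_even_sqr1 ?eqxx // (eqP s2).
have [s0|s0] := ifPn.
  rewrite /=; apply/esym/negbTE; apply: contraNN s2 => /andP[_ /eqP s1].
  by rewrite unity_meet // (eqP s0).
case: ifP => [_|_]; last by rewrite eqxx andbT.
by rewrite (ltn_eqF (ltnW (ltnW e_gt2))) andbF.
Qed.

Lemma card_JW_half : #|J @: W (e.+1)./2| = 2.
Proof.
have D : W (e.+1)./2 = [set s | s ^+ 2 == 1].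
  apply/setP => s; rewrite in_W !inE; have [s2|s2] := ifPn.
    by rewrite eqxx expr_even_sqr1 // ?eqxx // (eqP s2).
  by do !case: ifP => _; rewrite ?(gtn_eqF half_gt1) ?(ltn_eqF half_lt)
    ?(gtn_eqF (ltnW half_gt1)) andbF.
apply: double_inj; rewrite -!mul2n card_J_Wj D two_unity; congr (2 + _)%N.
rewrite -[RHS]two_unity; apply: eq_card => s; rewrite !inE andbb //.
Qed.

Lemma card_JW_other j : j \notin [:: 0; 1; (e.+1)./2; e]%N -> #|J @: W j| = 0%N.
Proof.
rewrite !inE !negb_or => /and4P[j0 j1 jh je].
apply/eqP; rewrite cards_eq0 imset_eq0 -subset0; apply/subsetP => s.
by rewrite in_W; do !case: ifP => _; rewrite 
  ?(negbTE j0, negbTE j1, negbTE jh, negbTE je) andbF.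
Qed.


(** * Transfer of the counts from [L] to [K] *)

Variables (K : finFieldType) (iota : {rmorphism K -> L}) (p n k : nat).
Hypotheses (pchar_L : p \in [pchar L]) (cardK : #|K| = (p ^ n)%N).
Hypothesis dE : (d * 2 = p ^ k + 1)%N.
Hypothesis in_V : forall t, t != 0 ->
  (t \in V) = (t ^+ (p ^ n) == t) || (t ^+ (p ^ n) == t^-1).
Hypothesis iota_J : forall v, exists2 t, t != 0 & iota v = J t.

Let f (x : K) := x ^+ d.
(** This is the scalar in front of the Dickson polynomial; the constant of the c-differential is -1
    throughout. *)
Let c : K := 2 / 4 ^+ d.

Lemma pnat_pexp j : [pchar L].-nat (p ^ j)%N.
Proof.
rewrite pnatX (eq_pnat _ (pcharf_eq pchar_L)) pnat_id ?orbT //.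
exact: pcharf_prime pchar_L.
Qed.

Lemma expr_pexpB1 t j : (t - 1) ^+ (p ^ j) = t ^+ (p ^ j) - 1.
Proof.
have := exprDn_pchar (t - 1) 1 (pnat_pexp j).
by rewrite subrK expr1n => ->; rewrite addrK.
Qed.

Lemma J_pexp t j : J t ^+ (p ^ j) = J (t ^+ (p ^ j)).
Proof. by rewrite /J (exprDn_pchar _ _ (pnat_pexp j)) exprVn. Qed.

(** Over [K], ['X^q - 'X] is the product of all ['X - v]; evaluating its image at [y] makes one
    factor vanish. *)
Lemma fixed_iota y : y ^+ (p ^ n) = y -> exists v, y = iota v.
Proof.
move=> yq; have := congr1 (fun P => (map_poly iota P).[y]) (finField_genPoly K).
rewrite rmorphB /= map_polyXn map_polyX !hornerE cardK yq subrr.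
rewrite rmorph_prod horner_prod => /esym/eqP/prodf_eq0[v _].
by rewrite rmorphB /= map_polyX map_polyC !hornerE subr_eq0 => /eqP; exists v.
Qed.

Lemma J_in_iota t : t \in V -> exists v, J t = iota v.
Proof.
move=> tV; apply: fixed_iota; rewrite J_pexp; move: (tV).
by rewrite in_V ?V_neq0 // => /orP[]/eqP ->; rewrite ?JV.
Qed.

(** An element coming from [K] is fixed by the q-power Frobenius, so [J (t ^+ q) = J t], and the
    fibres of [J] leave only [t] and [t^-1] for [t ^+ q]. *)
Lemma V_of_iota t v : t != 0 -> iota v = J t -> t \in V.
Proof.
move=> t0 Dv; rewrite in_V // -eq_J ?expf_neq0 // -J_pexp -Dv -rmorphXn /=.
by rewrite -cardK expf_card.
Qed.

Let iota2 : iota 2 = 2. Proof. exact: rmorph_nat. Qed.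
Let iota4 : iota 4 = 4. Proof. exact: rmorph_nat. Qed.
Let four_nz : 4 != 0 :> L.
Proof. by rewrite (_ : 4 = 2 * 2) ?mulf_neq0 // -natrM. Qed.
Let K4_nz : 4 != 0 :> K. Proof. by rewrite -(fmorph_eq0 iota) iota4. Qed.
Let K2_nz : 2 != 0 :> K. Proof. by rewrite -(fmorph_eq0 iota) iota2. Qed.
Let c_nz : c != 0. Proof. by rewrite mulf_neq0 ?invr_eq0 ?expf_neq0. Qed.

(* With 4x + 2 = t + 1/t one has x = (t-1)^2/(4t) and x + 1 = (t+1)^2/(4t);
   since 2d = p^k + 1, the d-th powers are computed by Frobenius. *)
Lemma cdiff_dickson x t : t != 0 -> iota (4 * x + 2) = J t ->
  iota (f (x + 1) - (-1) * f x) = iota c * J (t ^+ d).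
Proof.
move=> t0; rewrite mulN1r opprK /f /c (rmorphD _ (4 * x)) !rmorphM iota2 iota4.
rewrite (rmorphD _ (_ ^+ d)) fmorphV !rmorphXn iota4 (rmorphD _ x) rmorph1 /=.
move: (iota x) => X DX.
have EX : X = (t - 1) ^+ 2 / (4 * t).
  apply: (mulfI four_nz); apply: (addIr 2); rewrite DX /J; field.
  by rewrite t0 four_nz.
have EX1 : X + 1 = (t + 1) ^+ 2 / (4 * t).
  by rewrite EX; field; rewrite t0 four_nz.
rewrite EX1 EX !expr_div_n -!exprM (mulnC 2) dE !exprD !expr1 expr_pexpB1.
rewrite (exprDn_pchar _ _ (pnat_pexp k)) expr1n exprMn /J.
have wt : t ^+ (p ^ k) * t = t ^+ d * t ^+ d.
  by rewrite -[X in _ * X]expr1 -exprD -dE muln2 -addnn exprD.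
have u0 : t ^+ d != 0 by rewrite expf_neq0.
have F0 : 4 ^+ d != 0 :> L by rewrite expf_neq0.
(* The mixed terms of [(t ^+ (p ^ k) + 1) * (t + 1)] and [(t ^+ (p ^ k) - 1) * (t - 1)] cancel in
   the sum. *)
transitivity ((2 * (t ^+ (p ^ k) * t) + 2) / (4 ^+ d * t ^+ d)).
  by field; rewrite u0 F0.
by rewrite wt; field; rewrite u0 F0.
Qed.

(** The injection [x |-> 4 * x + 2] carries the solutions onto [J @: T s]: the equation becomes
    [J (t ^+ d) = J s], and if [t ^+ d] is [s^-1], then [t] is replaced by [t^-1]. *)
Lemma cdeltaE b s : s \in V -> iota b = J s -> cdelta (-1) f 1 (c * b) = N s.
Proof.
move=> sV Db; have s0 := V_neq0 sV.
pose g x := iota (4 * x + 2).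
have g_inj : injective g.
  by move=> x y /fmorph_inj/addIr/(mulfI K4_nz).
rewrite /cdelta -(card_imset _ g_inj); apply: eq_card => y.
apply/imsetP/imsetP => [[x + ->]|[t + ->]].
  rewrite inE => /eqP Dx; have [t t0 Dt] := iota_J (4 * x + 2).
  have tV := V_of_iota t0 Dt.
  have := cdiff_dickson t0 Dt; rewrite Dx rmorphM Db => /(mulfI _)/eqP.
  rewrite fmorph_eq0 c_nz eq_sym => /(_ isT).
  rewrite eq_J ?expf_neq0 // => /orP[td|td].
    by exists t => //; apply/setIdP.
  exists t^-1; last by rewrite JV.
  by apply/setIdP; rewrite V_inv // exprVn (eqP td) invrK.
move=> /setIdP[tV /eqP td]; have [v Dv] := J_in_iota tV.
have Dx : iota (4 * ((v - 2) / 4) + 2) = J t by rewrite mulrC divfK // subrK.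
exists ((v - 2) / 4); last by [].
rewrite inE -(inj_eq (fmorph_inj iota)); apply/eqP.
by rewrite (cdiff_dickson (V_neq0 tV) Dx) (rmorphM _ c b) Db td.
Qed.

Lemma comegaE j : comega (-1) f j = #|J @: W j|.
Proof.
pose g b := iota (b / c).
have g_inj : injective g.
  by move=> x y /fmorph_inj; apply: mulIf; rewrite invr_eq0.
rewrite /comega -(card_imset _ g_inj); apply: eq_card => y.
apply/imsetP/imsetP => [[b + ->]|[s + ->]].
  rewrite inE => /eqP Db; have [s s0 Ds] := iota_J (b / c).
  exists s; last by [].
  have sV := V_of_iota s0 Ds.
  by apply/setIdP; split=> //; rewrite -(cdeltaE sV Ds) mulrC divfK // Db.
move=> /setIdP[sV /eqP Ns]; have [v Dv] := J_in_iota sV.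
exists (c * v); last by rewrite /g mulrC mulKf.
by rewrite inE (cdeltaE sV (esym Dv)) Ns.
Qed.

Lemma comega_values :
  [/\ (2 * comega (-1)%R f 0 = m1 - m1 %/ e)%N,
      (2 * comega (-1)%R f 1 = m0 - 2)%N,
      comega (-1)%R f (e.+1)./2 = 2%N,
      (2 * comega (-1)%R f e = m1 %/ e - 2)%N &
      forall j, j \notin [:: 0; 1; (e.+1)./2; e]%N -> comega (-1)%R f j = 0%N].
Proof.
split=> [||||j nj]; rewrite comegaE.
- exact: double_card_JW0.
- exact: double_card_JW1.
- exact: card_JW_half.
- exact: double_card_JWe.
exact: card_JW_other.
Qed.

End Fibres.

End Joukowsky.

(** * The spectrum as rational expressions in [p] and [n] *)

Section Spectrum.

Variables (p n k : nat) (K : finFieldType).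
Hypotheses (p_prime : prime p) (p_mod4 : p = 1 %[mod 4]).
Hypotheses (n_gt0 : (0 < n)%N) (k_odd : odd k) (co_nk : coprime n k).
Hypothesis cardK : #|K| = (p ^ n)%N.

Let d := ((p ^ k + 1) %/ 2)%N.
Let e := ((p + 1) %/ 2)%N.

Let pchar_K : p \in [pchar K]. Proof. exact: card_finPcharP cardK p_prime. Qed.

Lemma nat_neq0_mod_pexp m : (m = p ^ n - 1 \/ m = p ^ n + 1)%N -> (m%:R : K) != 0.
Proof.
have pn0 : (p ^ n)%:R = 0 :> K.
  by apply/eqP; rewrite -(dvdn_pcharf pchar_K) dvdn_exp.
case=> ->; last by rewrite natrD pn0 add0r oner_neq0.
by rewrite natrB ?expn_gt0 ?prime_gt0 // pn0 sub0r oppr_eq0 oner_neq0.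
Qed.

Lemma expr_pred_eq1 (F : fieldType) (t : F) q : t != 0 -> (0 < q)%N ->
  (t ^+ (q - 1) == 1) = (t ^+ q == t).
Proof.
move=> t0 q_gt0; rewrite -[in RHS](subnK q_gt0) exprD expr1.
by rewrite -[X in _ = (_ == X)]mul1r (inj_eq (mulIf t0)).
Qed.

Lemma expr_succ_eq1 (F : fieldType) (t : F) q : t != 0 ->
  (t ^+ (q + 1) == 1) = (t ^+ q == t^-1).
Proof. by move=> t0; rewrite exprD expr1 -[RHS](inj_eq (mulIf t0)) mulVf. Qed.

Lemma comega_pow m0 m1 :
  (m0 = p ^ n - 1 /\ m1 = p ^ n + 1)%N \/ (m1 = p ^ n - 1 /\ m0 = p ^ n + 1)%N ->
  gcdn d m0 = 1%N -> gcdn d m1 = e ->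
  let w := comega (-1) (fun x : K => x ^+ d) in
  [/\ (2 * w 0 = m1 - m1 %/ e)%N, (2 * w 1 = m0 - 2)%N, w (e.+1)./2 = 2%N,
      (2 * w e = m1 %/ e - 2)%N &
      forall j, j \notin [:: 0; 1; (e.+1)./2; e]%N -> w j = 0%N].
Proof.
move=> Dm g0 g1 /=.
have p_gt4 : (4 < p)%N.
  by move: p_prime p_mod4; case: (p) => [|[|[|[|[|]]]]].
have pn_mod4 := expn_mod4 p_mod4 n.
have pn_gt1 : (1 < p ^ n)%N by rewrite -(expn0 p) ltn_exp2l // ltnW // ltnW // ltnW.
have m0_nz : (m0%:R : K) != 0.
  by apply: nat_neq0_mod_pexp; case: Dm => -[]; [left | right].
have m1_nz : (m1%:R : K) != 0.
  by apply: nat_neq0_mod_pexp; case: Dm => -[]; [right | left].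
have [L [iota [[z0 z0P] [z1 z1P] iotaJ]]] := exists_dickson_extension m0_nz m1_nz.
have pchar_L : p \in [pchar L] by rewrite (fmorph_pchar iota).
rewrite -g1.
apply: (@comega_values L m0 m1 d z0 z1 z0P z1P _ _ _ _ _ _ _ K iota p n k)
  => //.
(* The exponents q + 1 and q - 1 differ by 2. *)
- move=> t; case: Dm => -[-> ->] t0 t1.
    by rewrite -[RHS]t1 -[LHS]mul1r -[X in X * _]t0 -exprD; congr (_ ^+ _); lia.
  by rewrite -[RHS]t0 -[LHS]mul1r -[X in X * _]t1 -exprD; congr (_ ^+ _); lia.
- lia.
- lia.
- exact: odd_half_pow.
- by rewrite -(dvdn_pcharf pchar_L) gtnNdvd // ltnW // ltnW.
- by rewrite g1 /e; lia.
- exact: double_half_pow.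
move=> t t0; rewrite inE; case: Dm => -[-> ->].
  by rewrite (expr_pred_eq1 t0 (ltnW pn_gt1)) expr_succ_eq1.
by rewrite orbC (expr_pred_eq1 t0 (ltnW pn_gt1)) expr_succ_eq1.
Qed.

Lemma spectrum_of_gcds m0 m1 :
  (m0 = p ^ n - 1 /\ m1 = p ^ n + 1)%N \/ (m1 = p ^ n - 1 /\ m0 = p ^ n + 1)%N ->
  gcdn d m0 = 1%N -> gcdn d m1 = e ->
  has_cdiff_spectrum (-1) (fun x : K => x ^+ d)
    [:: (0%N, m1%:R * (p%:R - 1) / (2 * (p%:R + 1)));
        (1%N, (m0%:R - 2) / 2);
        (((p + 3) %/ 4)%N, 2);
        (e, (m1%:R - (p%:R + 1)) / (p%:R + 1))].
Proof.
move=> Dm g0 g1.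
have [w0 w1 wh we wo] := comega_pow Dm g0 g1.
have half : ((p + 3) %/ 4 = (e.+1)./2)%N by rewrite /e; move: p_mod4; lia.
have De : (e * 2 = p + 1)%N by apply: double_half_succ.
have e_odd : odd e by apply: odd_half_succ.
have em : (e %| m1)%N by rewrite -g1 dvdn_gcdr.
have pn_mod4 := expn_mod4 p_mod4 n.
have pn_gt1 : (1 < p ^ n)%N by rewrite -(expn0 p) ltn_exp2l // prime_gt1.
have [m0_ge2 m1_gt0 m1_even] : [/\ (2 <= m0)%N, (0 < m1)%N & ~~ odd m1].
  by case: Dm => -[-> ->]; split; lia.
set r := (m1 %/ e)%N in w0 we.
have Dm1 : (m1 = e * r)%N by rewrite mulnC divnK.
(* As [m1] is even and [e] odd, [r] is even and positive. This bound, [m0_ge2] and [r_le] keep the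
   natural subtractions from truncating when cast to the rationals. *)
have r_ge2 : (2 <= r)%N.
  move: m1_even m1_gt0; rewrite Dm1 oddM e_odd /=.
  by case: (r) => [|[|]]; rewrite ?muln0.
have Pe : p%:R = 2 * e%:R - 1 :> rat.
  by rewrite -natrM mulnC De natrD addrK.
have e_nz : e%:R != 0 :> rat by rewrite Num.Theory.pnatr_eq0 -lt0n odd_gt0.
have mQ : m1%:R = e%:R * r%:R :> rat by rewrite Dm1 natrM.
have halfQ w x : (2 * w)%:R = x -> w%:R = x / 2 :> rat.
  by move=> <-; rewrite natrM mulrC mulKf.
have r_le : (r <= m1)%N by rewrite leq_div.
split=> [i v|j]; last by rewrite /= half; apply: wo.
rewrite half !inE => /or4P[] /eqP[-> ->].
- rewrite (halfQ _ _ (congr1 _ w0)) natrB // mQ Pe subrK.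
  by field; rewrite e_nz.
- by rewrite (halfQ _ _ (congr1 _ w1)) natrB.
- by rewrite wh.
rewrite (halfQ _ _ (congr1 _ we)) natrB // mQ Pe subrK.
by field; rewrite e_nz.
Qed.

End Spectrum.

Theorem theorem11 (p n k : nat) (K : finFieldType)
    (p_prime : prime p) (p_mod4 : p = 1 %[mod 4])
    (n_gt0 : (0 < n)%N) (k_gt0 : (0 < k)%N)
    (coprime_nk : gcdn n k = 1%N)
    (even_quo : ~~ odd ((2 * n) %/ gcdn (2 * n) k))
    (cardK : #|K| = (p ^ n)%N) :
  (odd n ->
    has_cdiff_spectrum (-1 : K) (fun x : K => x ^+ ((p ^ k + 1) %/ 2))
      [:: (0%N, (p%:R ^+ n + 1) * (p%:R - 1) / (2 * (p%:R + 1)));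
          (1%N, (p%:R ^+ n - 3) / 2);
          (((p + 3) %/ 4)%N, 2);
          (((p + 1) %/ 2)%N, (p%:R ^+ n - p%:R) / (p%:R + 1))])
  /\
  (~~ odd n ->
    has_cdiff_spectrum (-1 : K) (fun x : K => x ^+ ((p ^ k + 1) %/ 2))
      [:: (0%N, (p%:R ^+ n - 1) * (p%:R - 1) / (2 * (p%:R + 1)));
          (1%N, (p%:R ^+ n - 1) / 2);
          (((p + 3) %/ 4)%N, 2);
          (((p + 1) %/ 2)%N, (p%:R ^+ n - p%:R - 2) / (p%:R + 1))]).
Proof.
have co : coprime n k by rewrite /coprime coprime_nk.
have k_odd := odd_of_even_quo n_gt0 co even_quo.
have pn_gt0 : (0 < p ^ n)%N by rewrite expn_gt0 prime_gt0.
have succQ : (p ^ n + 1)%:R = p%:R ^+ n + 1 :> rat by rewrite natrD natrX.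
have predQ : (p ^ n - 1)%:R = p%:R ^+ n - 1 :> rat by rewrite natrB // natrX.
(* The power map is bijective on the group of order q - 1 for odd [n] and on that of order q + 1 for
   even [n], which fixes the roles of [m0] and [m1]. *)
split=> n_par.
  have [g0 g1] := gcds_odd p_mod4 n_gt0 k_odd co n_par.
  have := spectrum_of_gcds p_prime p_mod4 n_gt0 k_odd co cardK
    (or_introl (conj erefl erefl)) g0 g1.
  have -> : (p ^ n + 1)%:R - (p%:R + 1) = p%:R ^+ n - p%:R :> rat.
    by rewrite succQ; ring.
  have -> : (p ^ n - 1)%:R - 2 = p%:R ^+ n - 3 :> rat.
    by rewrite predQ -addrA -opprD.
  by rewrite succQ.
have [g0 g1] := gcds_even p_mod4 n_gt0 k_odd co n_par.
have := spectrum_of_gcds p_prime p_mod4 n_gt0 k_odd co cardK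
  (or_intror (conj erefl erefl)) g0 g1.
have -> : (p ^ n - 1)%:R - (p%:R + 1) = p%:R ^+ n - p%:R - 2 :> rat.
  by rewrite predQ; ring.
have -> : (p ^ n + 1)%:R - 2 = p%:R ^+ n - 1 :> rat by rewrite succQ; ring.
by rewrite predQ.
Qed.
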